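(* Let $1\le r\le s\le t$ and $n=r+s+t+1$. Then the $(2r+2)$-wide diameter of $E3C(r,s,t)$ satisfies $D_{2r+2}(E3C(r,s,t))\le r+s+t+6=n+5$.
   Context: The exchanged 3-ary $n$-cube $E3C(r,s,t)$ ($r,s,t\ge1$, $n=r+s+t+1$): vertices are strings written $x=ABCd$ with $A\in\{0,1,2\}^r$, $B\in\{0,1,2\}^s$, $C\in\{0,1,2\}^t$, $d\in\{0,1,2\}$. Two distinct vertices $x=ABCd$, $y=A'B'C'd'$ are adjacent iff one of: (E0) $A=A',B=B',C=C'$ and $d\ne d'$; (E1) $d=d'=0$, $A=A'$, $B=B'$ and $C,C'$ differ in exactly one position; (E2) $d=d'=1$, $A=A'$, $C=C'$ and $B,B'$ differ in exactly one position; (E3) $d=d'=2$, $B=B'$, $C=C'$ and $A,A'$ differ in exactly one position. For a graph $G$ and positive integer $\beta\le\kappa(G)$ (vertex connectivity), the $\beta$-wide diameter $D_\beta(G)$ is the maximum over distinct $u,v\in V(G)$ of the minimum, over all families of $\beta$ pairwise internally disjoint $u$–$v$ paths, of the maximum length of a path in the family. (It is known that $\kappa(E3C(r,s,t))=2r+2$ when $r\le s\le t$.) *)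

(* Defs.v *)
From mathcomp Require Import all_boot.
Set Implicit Arguments. Unset Strict Implicit. Unset Printing Implicit Defensive.

Definition is_path (T : finType) (e : rel T) (u v : T) (p : seq T) : Prop :=
  exists q : seq T, [/\ p = u :: q, path e u q, last u q = v & uniq p].

Definition path_length (T : eqType) (p : seq T) : nat := (size p).-1.

Definition internally_disjoint (T : eqType) (u v : T) (p q : seq T) : Prop :=
  forall x, x \in p -> x \in q -> x = u \/ x = v.

Definition disjoint_path_family (T : finType) (e : rel T) (b d : nat) (u v : T)
  (P : 'I_b -> seq T) : Prop :=
  (forall i, @is_path T e u v (P i) /\ path_length (P i) <= d) /\
  (forall i j, i != j -> P i <> P j /\ internally_disjoint u v (P i) (P j)).

(* D_b(G) <= d : for every pair of distinct vertices u, v the minimum, over all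
   families of b pairwise internally disjoint u-v paths, of the maximal length
   is at most d, i.e. some such family has all lengths <= d. *)
Definition wide_diameter_le (T : finType) (e : rel T) (b d : nat) : Prop :=
  forall u v : T, u != v -> exists P : 'I_b -> seq T, @disjoint_path_family T e b d u v P.

Definition word (k : nat) := {ffun 'I_k -> 'I_3}.

Definition E3C_vertex (r s t : nat) : finType :=
  (word r * word s * word t * 'I_3)%type.

Definition differ_in_one (k : nat) (X Y : word k) : bool :=
  #|[set i | X i != Y i]| == 1.

Definition E3C_adj (r s t : nat) : rel (E3C_vertex r s t) :=
  fun x y =>
    let: (A, B, C, d) := x in
    let: (A', B', C', d') := y in
    [|| [&& A == A', B == B', C == C' & d != d'] ,
        [&& (d == 0 :> nat), (d' == 0 :> nat), A == A', B == B' & differ_in_one C C'] ,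
        [&& (d == 1 :> nat), (d' == 1 :> nat), A == A', C == C' & differ_in_one B B']
      | [&& (d == 2 :> nat), (d' == 2 :> nat), B == B', C == C' & differ_in_one A A'] ].

(* Main.v *)
Require Import Defs.
From mathcomp Require Import all_boot zify.
Set Implicit Arguments. Unset Strict Implicit. Unset Printing Implicit Defensive.

(** A vertex is a triple of words together with a label saying which word may
be changed, so E3C is assembled from three Hamming graphs over a 3-letter
alphabet. From each Hamming graph of dimension [k] one only needs: diameter at
most [k]; [2k] neighbours at every vertex; a detour of total length at most
[k + 1] through a vertex different from both ends; and, between distinct words,
a walk of length at most [k] together with [2k - 1] further disjoint paths of
length at most [k + 1]. For two vertices of E3C most of the [2r + 2] paths first
move to distinct neighbours (or distinct container paths) in the factor of [u]'s
label, and keep that coordinate as an identity tag while the two other words are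
rewritten; when the labels differ the tag is exchanged halfway for a neighbour of
[v] in the factor of [v]'s label. The two or three remaining paths run through
values of the words that the tagged paths avoid. Permuting the three factors and
reversing paths leaves only the label pairs (0,0) and (0,1). Only confinement to
pairwise disjoint vertex sets has to be checked, since a walk can be shortened to
a path inside the same set. *)

(** * Walks confined to a vertex set *)

Section Walks.
Variables (T : eqType) (e : rel T).

(** Vertices may repeat, so that confined walks concatenate freely; [walk_in_uniq] removes the
    repetitions inside the same set. *)
Definition walk_in (S : T -> Prop) (n : nat) (x y : T) : Prop :=
  exists p, [/\ path e x p, last x p = y, size p <= n
            & forall z, z \in x :: p -> S z].

(* [p] is the list of internal vertices; requiring it to be nonempty keeps two
   members of a family from both being the edge [x y]. *)
Definition inner_walk_in (S : T -> Prop) (n : nat) (x y : T) : Prop :=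
  exists p, [/\ p <> [::], path e x (rcons p y), size p < n, uniq p
            & forall z, z \in p -> [/\ S z, z <> x & z <> y]].

Lemma walk_in_refl (S : T -> Prop) n x : S x -> walk_in S n x x.
Proof. by move=> Sx; exists [::]; split=> // z; rewrite inE => /eqP ->. Qed.

Lemma walk_in_leq (S : T -> Prop) n n' x y :
  walk_in S n x y -> n <= n' -> walk_in S n' x y.
Proof. by case=> p [pp lp sp Sp] le; exists p; split=> //; apply: leq_trans le. Qed.

Lemma walk_in_sub (S S' : T -> Prop) n x y :
  (forall z, S z -> S' z) -> walk_in S n x y -> walk_in S' n x y.
Proof. by move=> sub [p [pp lp sp Sp]]; exists p; split=> // z /Sp /sub. Qed.

Lemma walk_in_trans (S : T -> Prop) n n' x y z :
  walk_in S n x y -> walk_in S n' y z -> walk_in S (n + n') x z.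
Proof.
case=> p [pp lp sp Sp] [q [pq lq sq Sq]]; exists (p ++ q); split.
- by rewrite cat_path pp lp.
- by rewrite last_cat lp.
- by rewrite size_cat leq_add.
- move=> w; rewrite -cat_cons mem_cat => /orP[/Sp //|wq].
  by apply: Sq; rewrite inE wq orbT.
Qed.

Lemma walk_in_cons (S : T -> Prop) n x y z :
  S x -> e x y -> walk_in S n y z -> walk_in S n.+1 x z.
Proof.
move=> Sx exy [p [pp lp sp Sp]]; exists (y :: p); split=> //=; first by rewrite exy.
by move=> w; rewrite inE => /orP[/eqP -> //|/Sp].
Qed.

Lemma walk_in_edge (S : T -> Prop) x y :
  S x -> S y -> e x y -> walk_in S 1 x y.
Proof. by move=> Sx Sy exy; apply: walk_in_cons exy _ => //; apply: walk_in_refl. Qed.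

Lemma walk_in_endpoints (S : T -> Prop) n x y : walk_in S n x y -> S x /\ S y.
Proof.
by case=> p [_ <- _ Sp]; split; apply: Sp; [apply: mem_head | apply: mem_last].
Qed.

Lemma walk_in_uniq (S : T -> Prop) n x y : walk_in S n x y ->
  exists p, [/\ path e x p, last x p = y, size p <= n, uniq (x :: p)
            & forall z, z \in x :: p -> S z].
Proof.
case=> p [pp]; case/shortenP: pp => q pq uq sub lq sp Sp; exists q; split=> //.
- by apply: leq_trans sp; apply: uniq_leq_size => //; case/andP: uq.
- move=> z; rewrite inE => /orP[/eqP ->|/sub zp]; apply: Sp; rewrite inE ?eqxx //.
  by rewrite zp orbT.
Qed.

Lemma inner_walk_in_leq (S : T -> Prop) n n' x y :
  inner_walk_in S n x y -> n <= n' -> inner_walk_in S n' x y.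
Proof.
by case=> p [np pp sp up Sp] le; exists p; split=> //; apply: leq_trans le.
Qed.

(** When [S] misses both ends, the whole walk from [a] to [b] is interior, and the two attaching
    edges add two to the length. *)
Lemma inner_walk_in_ends (S : T -> Prop) n x y a b :
  (forall z, S z -> z <> x /\ z <> y) -> e x a -> e b y ->
  walk_in S n a b -> inner_walk_in S n.+2 x y.
Proof.
move=> Sxy exa eby /walk_in_uniq[p [pp lp sp up Sp]]; exists (a :: p); split=> //=.
- by rewrite exa rcons_path pp lp.
- by move=> z /Sp Sz; have [] := Sxy _ Sz; split.
Qed.

(** A walk between distinct nonadjacent ends keeps an interior vertex after shortening, so here [S]
    may contain the ends. *)
Lemma inner_walk_in_nonadj (S : T -> Prop) n x y :
  ~~ e x y -> x <> y -> walk_in S n x y -> inner_walk_in S n x y.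
Proof.
move=> nxy xy /walk_in_uniq[p]; case/lastP: p => [[_ /xy]//|p z].
rewrite last_rcons size_rcons -rcons_cons rcons_uniq inE negb_or /=.
case=> pp zy sp; subst z => /andP[/andP[_ yp] /andP[xp up]] Sp; exists p; split=> //.
- by move=> p0; move: pp nxy; rewrite p0 /= andbT => ->.
- move=> w wp; split; first by apply: Sp; rewrite inE mem_rcons inE wp !orbT.
  + by move=> wx; rewrite -wx wp in xp.
  + by move=> wy; rewrite -wy wp in yp.
Qed.

(** Detaches the first interior vertex [a], which later serves as the tag of a path; the rest, one
    edge shorter, can be replayed after other coordinates have changed. *)
Lemma inner_walk_in_head (S : T -> Prop) n x y : inner_walk_in S n x y ->
  exists a, [/\ e x a, S a, a <> x, a <> y
            & walk_in (fun z => S z \/ z = y) n.-1 a y].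
Proof.
case=> [[|a p]] [// _ /= /andP[exa pp] sp up Sp].
have [Sa ax ay] := Sp a (mem_head _ _); exists a; split=> //.
exists (rcons p y); split=> //; first by rewrite last_rcons.
- by rewrite size_rcons; lia.
- move=> z; rewrite inE mem_rcons inE => /or3P[/eqP ->|/eqP ->|zp]; auto.
  by left; case: (Sp z) => //; rewrite inE zp orbT.
Qed.

Lemma inner_walk_in_last (S : T -> Prop) n x y : inner_walk_in S n x y ->
  exists b, [/\ e b y, S b, b <> x & b <> y].
Proof.
case=> p; case/lastP: p => [[]//|p b] [_].
rewrite !rcons_path last_rcons => /andP[_ eby] _ _ Sp; exists b.
by case: (Sp b) => //; rewrite mem_rcons mem_head.
Qed.

End Walks.

Lemma walk_in_map (T T' : eqType) (e : rel T) (e' : rel T') (f : T -> T')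
    (S : T -> Prop) (S' : T' -> Prop) n x y :
  {homo f : x y / e x y >-> e' x y} -> (forall z, S z -> S' (f z)) ->
  walk_in e S n x y -> walk_in e' S' n (f x) (f y).
Proof.
move=> fe sub [p [pp lp sp Sp]]; exists (map f p); split.
- exact: homo_path pp.
- by rewrite last_map lp.
- by rewrite size_map.
- by move=> z; rewrite -map_cons => /mapP[w /Sp/sub ? ->].
Qed.

Lemma inner_walk_in_map (T T' : eqType) (e : rel T) (e' : rel T') (f : T -> T')
    (S : T -> Prop) (S' : T' -> Prop) n x y :
  injective f ->
  {homo f : x y / e x y >-> e' x y} -> (forall z, S z -> S' (f z)) ->
  inner_walk_in e S n x y -> inner_walk_in e' S' n (f x) (f y).
Proof.
move=> fI fe sub [p [np pp sp up Sp]]; exists (map f p); split.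
- by case: p np {pp sp up Sp}.
- by rewrite -map_rcons; apply: homo_path pp.
- by rewrite size_map.
- by rewrite map_inj_uniq.
- by move=> z /mapP[w /Sp[/sub Sw wx wy] ->]; split=> // /fI.
Qed.

(** * Families of pairwise disjoint paths *)

Definition disjoint_walks (T : finType) (e : rel T) (b d : nat) (u v : T) : Prop :=
  exists P : 'I_b -> seq T, disjoint_path_family e d u v P.

Section Families.
Variables (T : finType) (e : rel T) (d : nat) (u v : T).

(** One path, confined to [S], may be the bare edge from [u] to [v]; all others have an interior
    vertex. Such a vertex lies on no other path, so disjointness also makes the lists distinct. *)
Lemma disjoint_walks_fin (J : finType) (b : nat) (S : T -> Prop) (F : J -> T -> Prop) :
  b = #|J|.+1 -> u <> v ->
  walk_in e S d u v -> (forall j, inner_walk_in e (F j) d u v) ->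
  (forall j w, S w -> F j w -> w <> u -> w <> v -> False) ->
  (forall i j w, F i w -> F j w -> w <> u -> w <> v -> i = j) ->
  disjoint_walks e b d u v.
Proof.
move=> -> uv /walk_in_uniq[p0 [pp0 lp0 sp0 up0 Sp0]] /fin_all_exists[p Hp] dS dF.
have cJ : #|{: option J}| = #|J|.+1 by rewrite card_option.
pose Q (o : option J) := if o is Some j then u :: rcons (p j) v else u :: p0.
have QP o : is_path e u v (Q o) /\ path_length (Q o) <= d.
  case: o => [j|] /=; last by split=> //; exists p0.
  have [np pp sp up Fp] := Hp j; rewrite /path_length /= size_rcons; split=> //.
  exists (rcons (p j) v); split=> //; first by rewrite last_rcons.
  rewrite /= mem_rcons inE negb_or rcons_uniq up; apply/and3P; split=> //.
  - apply/andP; split; first exact/eqP.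
    by apply/negP=> /Fp[].
  - by apply/negP=> /Fp[].
have mQ j x : x \in Q (Some j) -> [\/ x = u, x = v | x \in p j].
  by rewrite /= inE mem_rcons inE => /or3P[/eqP|/eqP|] ?;
     [constructor 1 | constructor 2 | constructor 3].
have disj o o' : o != o' -> internally_disjoint u v (Q o) (Q o').
  move=> oo' x xo xo'.
  have [-> | /eqP xu] := eqVneq x u; first by left.
  have [-> | /eqP xv] := eqVneq x v; first by right.
  exfalso; case: o o' oo' xo xo' => [j|] [j'|] // oo'.
  - move=> /mQ[//|//|xj] /mQ[//|//|xj'].
    have [_ _ _ _ /(_ x xj)[Fj _ _]] := Hp j.
    have [_ _ _ _ /(_ x xj')[Fj' _ _]] := Hp j'.
    by case/eqP: oo'; congr Some; apply: dF Fj Fj' xu xv.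
  - move=> /mQ[//|//|xj] /= x0.
    have [_ _ _ _ /(_ x xj)[Fj _ _]] := Hp j.
    exact: dS (Sp0 _ x0) Fj xu xv.
  - move=> /= x0 /mQ[//|//|xj].
    have [_ _ _ _ /(_ x xj)[Fj _ _]] := Hp j'.
    exact: dS (Sp0 _ x0) Fj xu xv.
have neq o o' : o != o' -> Q o <> Q o'.
  wlog [j ->] : o o' / exists j, o = Some j.
    case: o o' => [j|] [j'|] // H; try by apply: H; eexists.
    by rewrite eq_sym => /H -/(_ (ex_intro _ j' erefl)) Hn /esym.
  move=> oo' eqQ; have [np _ _ _ Fp] := Hp j.
  have [x xp] : exists x, x \in p j by case: (p j) np => // a q _; exists a; rewrite mem_head.
  have [_ xu xv] := Fp x xp.
  have xQ : x \in Q (Some j) by rewrite /= inE mem_rcons inE xp !orbT.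
  by have [] := disj _ _ oo' x xQ; rewrite -?eqQ.
exists (fun i => Q (enum_val (cast_ord (esym cJ) i))); split=> [i|i j ij]; first exact: QP.
have nij : enum_val (cast_ord (esym cJ) i) != enum_val (cast_ord (esym cJ) j).
  by apply: contraNN ij => /eqP/enum_val_inj/cast_ord_inj ->.
by split; [apply: neq | apply: disj].
Qed.

Lemma disjoint_walks2 n (S1 S2 : T -> Prop) (F : 'I_n -> T -> Prop) :
  u <> v ->
  walk_in e S1 d u v -> inner_walk_in e S2 d u v ->
  (forall i, inner_walk_in e (F i) d u v) ->
  (forall w, S1 w -> S2 w -> w <> u -> w <> v -> False) ->
  (forall i w, S1 w -> F i w -> w <> u -> w <> v -> False) ->
  (forall i w, S2 w -> F i w -> w <> u -> w <> v -> False) ->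
  (forall i j w, F i w -> F j w -> w <> u -> w <> v -> i = j) ->
  disjoint_walks e n.+2 d u v.
Proof.
move=> uv W1 W2 WF d12 d1 d2 dF.
apply: (@disjoint_walks_fin (option 'I_n) _ S1
          (fun o => if o is Some i then F i else S2)) => //.
- by rewrite card_option card_ord.
- by case.
- by case=> [i|] w; [apply: d1 | apply: d12].
- case=> [i|] [j|] w //= h1 h2 wu wv; first by congr Some; apply: dF h1 h2 wu wv.
  + by case: (d2 i w).
  + by case: (d2 j w).
Qed.

Lemma disjoint_walks3 n (S1 S2 S3 : T -> Prop) (F : 'I_n -> T -> Prop) :
  u <> v ->
  walk_in e S1 d u v -> inner_walk_in e S2 d u v -> inner_walk_in e S3 d u v ->
  (forall i, inner_walk_in e (F i) d u v) ->
  (forall w, S1 w -> S2 w -> w <> u -> w <> v -> False) ->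
  (forall w, S1 w -> S3 w -> w <> u -> w <> v -> False) ->
  (forall w, S2 w -> S3 w -> w <> u -> w <> v -> False) ->
  (forall i w, S1 w -> F i w -> w <> u -> w <> v -> False) ->
  (forall i w, S2 w -> F i w -> w <> u -> w <> v -> False) ->
  (forall i w, S3 w -> F i w -> w <> u -> w <> v -> False) ->
  (forall i j w, F i w -> F j w -> w <> u -> w <> v -> i = j) ->
  disjoint_walks e n.+3 d u v.
Proof.
move=> uv W1 W2 W3 WF d12 d13 d23 d1 d2 d3 dF.
apply: (@disjoint_walks_fin (option (option 'I_n)) _ S1
  (fun o => match o with Some (Some i) => F i | Some None => S3 | None => S2 end)) => //.
- by rewrite !card_option card_ord.
- by case=> [[]|].
- by case=> [[i|]|] w; [apply: d1 | apply: d13 | apply: d12].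
- case=> [[i|]|] [[j|]|] w //= h1 h2 wu wv.
  + by do 2 congr Some; apply: dF h1 h2 wu wv.
  + by case: (d3 i w).
  + by case: (d2 i w).
  + by case: (d3 j w).
  + by case: (d23 w).
  + by case: (d2 j w).
  + by case: (d23 w).
Qed.

End Families.

Lemma disjoint_walks_map (T T' : finType) (e : rel T) (e' : rel T') (f : T -> T')
    b d u v :
  injective f -> {homo f : x y / e x y >-> e' x y} ->
  disjoint_walks e b d u v -> disjoint_walks e' b d (f u) (f v).
Proof.
move=> fI fe [P [PP Pd]]; exists (fun i => map f (P i)); split=> [i|i j ij].
- have [[q [Pq pq lq uq]] sq] := PP i; rewrite /path_length size_map; split=> //.
  exists (map f q); rewrite Pq; split=> //; first exact: homo_path pq.
  + by rewrite last_map lq.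
  + by rewrite map_inj_uniq // -Pq.
- have [nP dP] := Pd i j ij; split; first by move=> /(inj_map fI).
  move=> _ /mapP[x xi ->]; rewrite mem_map // => /(dP x xi).
  by case=> ->; [left | right].
Qed.

Lemma disjoint_walks_sym (T : finType) (e : rel T) b d u v :
  symmetric e -> disjoint_walks e b d u v -> disjoint_walks e b d v u.
Proof.
move=> es [P [PP Pd]]; exists (fun i => rev (P i)); split=> [i|i j ij].
- have [[q [Pq pq lq uq]] sq] := PP i; rewrite /path_length size_rev; split=> //.
  exists (behead (rev (P i))); rewrite rev_uniq Pq.
  have -> : rev (u :: q) = v :: rev (belast u q) by rewrite lastI lq rev_rcons.
  rewrite Pq in uq; split=> //=.
  + by rewrite -lq rev_path (eq_path (e' := e)) // => x y; rewrite es.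
  + case: q {Pq pq uq} lq => [//|x q] _ /=.
    by rewrite rev_cons last_rcons.
- have [nP dP] := Pd i j ij; split; first by move=> /(can_inj revK).
  by move=> x; rewrite !mem_rev => /dP h /h; case; [right | left].
Qed.

(** * Hamming graphs over three letters *)

Definition word_cons k (a : 'I_3) (x : word k) : word k.+1 :=
  [ffun i => if unlift ord0 i is Some j then x j else a].
Definition word_head k (w : word k.+1) : 'I_3 := w ord0.
Definition word_tail k (w : word k.+1) : word k := [ffun j => w (lift ord0 j)].

Lemma word_consK k a (x : word k) : word_tail (word_cons a x) = x.
Proof. by apply/ffunP=> j; rewrite !ffunE liftK. Qed.

Lemma word_head_cons k a (x : word k) : word_head (word_cons a x) = a.
Proof. by rewrite /word_head ffunE unlift_none. Qed.

Lemma word_cons_inj k a : injective (@word_cons k a).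
Proof. by move=> x y /(congr1 (@word_tail k)); rewrite !word_consK. Qed.

Lemma word_eta k (w : word k.+1) : w = word_cons (word_head w) (word_tail w).
Proof.
apply/ffunP=> i; rewrite ffunE; case: unliftP => [j ->|-> //].
by rewrite ffunE.
Qed.

(** Exhibits the Hamming graph of dimension [k.+1] as the Cartesian product of a triangle, the head
    letter, with that of dimension [k]; the inductions on the dimension rest on this form. *)
Lemma differ_in_one_cons k a b (x y : word k) :
  differ_in_one (word_cons a x) (word_cons b y) =
  (a != b) && (x == y) || (a == b) && differ_in_one x y.
Proof.
rewrite /differ_in_one -!sum1dep_card big_mkcond big_ord_recl -big_mkcond /=.
rewrite !ffunE unlift_none (eq_bigl (fun i => x i != y i)) => [|i]; last first.
  by rewrite !ffunE liftK.
rewrite sum1dep_card; have [_|_] /= := eqVneq a b; first by rewrite add0n.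
(* The heads already account for one difference, and [1 + n == 1] is convertible to [n == 0]. *)
rewrite orbF -[_ == 1]/(_ == 0) cards_eq0; apply/eqP/eqP => [h|->].
  by apply/ffunP=> i; apply/eqP; apply: contraFT (in_set0 i); rewrite -h inE.
by apply/setP=> i; rewrite !inE eqxx.
Qed.

Lemma differ_in_one_sym k : symmetric (@differ_in_one k).
Proof.
move=> x y; rewrite /differ_in_one; congr (_ == 1); apply: eq_card => i.
by rewrite !inE eq_sym.
Qed.

Lemma differ_in_one_irr k : irreflexive (@differ_in_one k).
Proof.
move=> x; rewrite /differ_in_one (_ : [set _ | _] = set0) ?cards0 //.
by apply/setP=> i; rewrite !inE eqxx.
Qed.

Lemma I3_third (a b : 'I_3) : exists c, c <> a /\ c <> b.
Proof.
have: 0 < #|~: [set a; b]| by rewrite cardsCs setCK card_ord subn_gt0 cards2; case: (a != b).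
by case/card_gt0P=> c; rewrite !inE negb_or => /andP[/eqP ? /eqP ?]; exists c.
Qed.

Lemma I3_others (a : 'I_3) : exists b c, [/\ b <> a, c <> a & b <> c].
Proof.
have [b [ba _]] := I3_third a a; have [c [ca cb]] := I3_third a b.
by exists b, c; split=> // /esym.
Qed.

Lemma edge_head k a b (x : word k) : a <> b ->
  differ_in_one (word_cons a x) (word_cons b x).
Proof. by move=> /eqP ab; rewrite differ_in_one_cons ab eqxx. Qed.

Lemma edge_tail k a : {homo @word_cons k a : x y / differ_in_one x y}.
Proof. by move=> x y xy; rewrite differ_in_one_cons xy eqxx orbT. Qed.

Lemma hamming_diam k (S : word k -> Prop) x y :
  (forall z, S z) -> walk_in (@differ_in_one k) S k x y.
Proof.
elim: k S x y => [|k IH] S x y ST.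
  by have -> : x = y; [apply/ffunP; case | apply: walk_in_refl].
rewrite (word_eta x) (word_eta y); set a := word_head x; set b := word_head y.
have W : walk_in (@differ_in_one k.+1) S k (word_cons b (word_tail x)) (word_cons b (word_tail y)).
  by apply: (walk_in_map (@edge_tail k b)) (IH (fun=> True) _ _ _).
have [ab|/eqP ab] := eqVneq a b; first by rewrite ab; apply: walk_in_leq W _.
by apply: walk_in_cons W => //; apply: edge_head.
Qed.

(** The two other head letters give two neighbours and the tail gives the rest. The index type is
    any [finType], so that an inductive step adds its two indices with [option]. *)
Lemma hamming_nbrs k (x : word k) : exists (J : finType) (f : J -> word k),
  [/\ #|J| = 2 * k, injective f & forall i, differ_in_one x (f i)].
Proof.
elim: k x => [|k IH] x; first by exists 'I_0, (fun=> x); rewrite card_ord; split=> // -[].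
rewrite (word_eta x); set a := word_head x; set y := word_tail x.
have [J [f [cJ fI fe]]] := IH y; have [b [c [ba ca bc]]] := I3_others a.
exists (option (option J)), (fun o => match o with
  | Some (Some j) => word_cons a (f j)
  | Some None => word_cons b y
  | None => word_cons c y end); split.
- by rewrite !card_option cJ; lia.
- case=> [[i|]|] [[j|]|] // h; [by rewrite (fI _ _ (word_cons_inj h)) | ..];
    by move/(congr1 (@word_head k)): h; rewrite !word_head_cons; congruence.
- by case=> [[i|]|]; [apply: edge_tail | apply: edge_head; auto..].
Qed.

(** One edge replaces the head letter by one that differs from both heads, and then the diameter
    bound applies; avoiding both ends costs a single extra edge. *)
Lemma hamming_detour k (x y : word k.+1) : exists z n1 n2,
  [/\ z <> x, z <> y, n1 + n2 <= k.+2,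
      walk_in (@differ_in_one k.+1) (fun=> True) n1 x z
    & walk_in (@differ_in_one k.+1) (fun=> True) n2 z y].
Proof.
have [c [cx cy]] := I3_third (word_head x) (word_head y).
exists (word_cons c (word_tail x)), 1, k.+1; split=> //.
- by move/(congr1 (@word_head k)); rewrite word_head_cons.
- by move/(congr1 (@word_head k)); rewrite word_head_cons.
- by apply: walk_in_edge => //; rewrite {1}(word_eta x); apply: edge_head; auto.
- exact: hamming_diam.
Qed.

(* When both head and tail differ, the distinguished path in [S] is
   traversed twice, before and after changing the head letter. *)
Lemma hamming_container k (x y : word k) : x <> y ->
  exists (J : finType) (S : word k -> Prop) (F : J -> word k -> Prop),
  [/\ #|J|.+1 = 2 * k, walk_in (@differ_in_one k) S k x y,
      forall j, inner_walk_in (@differ_in_one k) (F j) k.+1 x y,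
      forall j z, S z -> F j z -> False
    & forall i j z, F i z -> F j z -> i = j].
Proof.
elim: k x y => [|k IH] x y xy; first by case: xy; apply/ffunP; case.
rewrite (word_eta x) (word_eta y).
set a := word_head x; set b := word_head y; set x' := word_tail x; set y' := word_tail y.
(* Equal tails: the words are joined by an edge, the third head letter gives a path of length 2, and
   each neighbour [f j] of the tail gives one of length 3. *)
have [xy'|/eqP xy'] := eqVneq x' y'.
  have ab : a <> b by move=> ab; apply: xy; rewrite (word_eta x) (word_eta y) -/x' -/a xy' ab.
  have [J [f [cJ fI fe]]] := hamming_nbrs x'; have [c [ca cb]] := I3_third a b.
  have fx j : f j <> x' by move=> h; have := fe j; rewrite h differ_in_one_irr.
  rewrite -xy'; exists (option J), (fun w => word_tail w = x' /\ word_head w <> c).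
  exists (fun o w => if o is Some j then word_tail w = f j
                     else word_tail w = x' /\ word_head w = c); split.
  - by rewrite card_option cJ; lia.
  - by apply: (@walk_in_leq _ _ _ 1) => //; apply: walk_in_edge;
      rewrite ?word_consK ?word_head_cons; auto; apply: edge_head.
  (* Length 3 is at most [k.+2] only when [0 < k]; for [k = 0] there is no index [j]. *)
  - have k0 (j : J) : 0 < k.
      have: 0 < #|J| by apply/card_gt0P; exists j.
      by rewrite cJ; lia.
    case=> [j|].
    + apply: (@inner_walk_in_leq _ _ _ 3); last by have := k0 j; lia.
      apply: (inner_walk_in_ends (a := word_cons a (f j)) (b := word_cons b (f j))).
      * by move=> z zf; split=> zx; apply: (fx j); rewrite -zf zx word_consK.
      * exact: edge_tail.
      * by apply: edge_tail; rewrite differ_in_one_sym.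
      * by apply: walk_in_edge; rewrite ?word_consK //; apply: edge_head.
    + apply: (@inner_walk_in_leq _ _ _ 2); last by lia.
      apply: (inner_walk_in_ends (a := word_cons c x') (b := word_cons c x')).
      * by move=> z [_ zc]; split=> zx; rewrite zx word_head_cons in zc; auto.
      * by apply: edge_head; auto.
      * by apply: edge_head; auto.
      * by apply: walk_in_refl; rewrite word_consK word_head_cons.
  - by case=> [j|] z; [move=> [zx _] zf; apply: (fx j); congruence | move=> [_ +] [_ +]].
  - case=> [i|] [j|] z //.
    + by move=> -> /fI ->.
    + by move=> zf [zx _]; case: (fx i); congruence.
    + by move=> [zx _] zf; case: (fx j); congruence.
have [J [S [F [cJ WS WF dS dF]]]] := IH _ _ xy'.
(* Equal heads: the container of the tails is copied at head [a], and each of the two other layers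
   carries one further path. *)
have [ab|/eqP ab] := eqVneq a b.
  rewrite -ab; have [c [d [ca da cd]]] := I3_others a.
  have layer e : e <> a -> inner_walk_in (@differ_in_one k.+1)
      (fun w => word_head w = e) k.+2 (word_cons a x') (word_cons a y').
    move=> ea; apply: (inner_walk_in_ends (a := word_cons e x') (b := word_cons e y')).
    - by move=> z ze; split=> zx; rewrite zx word_head_cons in ze; auto.
    - by apply: edge_head; auto.
    - exact: edge_head.
    - apply: (walk_in_map (@edge_tail k e) (S := fun=> True)); last exact: hamming_diam.
      by move=> z _; rewrite word_head_cons.
  exists (option (option J)), (fun w => S (word_tail w) /\ word_head w = a).
  exists (fun o w => match o with
    | Some (Some j) => F j (word_tail w) /\ word_head w = a
    | Some None => word_head w = c
    | None => word_head w = d end); split.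
  - by rewrite !card_option; lia.
  - apply: (@walk_in_leq _ _ _ k) => //.
    apply: (walk_in_map (@edge_tail k a)) WS => z Sz.
    by rewrite word_consK word_head_cons.
  - case=> [[j|]|]; try exact: layer.
    apply: (@inner_walk_in_leq _ _ _ k.+1) => //.
    apply: (inner_walk_in_map (@word_cons_inj k a) (@edge_tail k a)) (WF j) => z Fz.
    by rewrite word_consK word_head_cons.
  - by case=> [[j|]|] z; [case=> Sz _ [Fz _]; apply: dS Sz Fz | case=> _; congruence..].
  - case=> [[i|]|] [[j|]|] z //; try (by move=> h1 h2; exfalso; intuition congruence).
    by move=> [Fi _] [Fj _]; rewrite (dF _ _ _ Fi Fj).
(* Heads and tails both differ: the remaining paths of the tail container change head at their first
   interior vertex, and the third letter [c] is reserved for one last path. *)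
have [c [ca cb]] := I3_third a b.
set u := word_cons a x'; set v := word_cons b y'.
have uv : u <> v by move=> /(congr1 (@word_head k)); rewrite !word_head_cons.
have nuv : ~~ differ_in_one u v.
  by rewrite differ_in_one_cons (introF eqP ab) (introF eqP xy').
(* The sets may contain [u] and [v] while the walks are built; both are then removed, because the
   disjointness required here makes no exception for the ends. *)
have IW (Q : word k.+1 -> Prop) : walk_in (@differ_in_one k.+1) Q k.+2 u v ->
    inner_walk_in (@differ_in_one k.+1) (fun w => [/\ Q w, w <> u & w <> v]) k.+2 u v.
  move=> /(inner_walk_in_nonadj nuv uv)[p [np pp sp up Qp]].
  by exists p; split=> // z /Qp[? ? ?]; split.
have lift e : walk_in (@differ_in_one k.+1) (fun w => S (word_tail w) /\ word_head w = e)
    k (word_cons e x') (word_cons e y').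
  apply: (walk_in_map (@edge_tail k e)) WS => z Sz.
  by rewrite word_consK word_head_cons.
have uE z : word_tail z = x' -> word_head z = a -> z = u.
  by move=> h1 h2; rewrite (word_eta z) h1 h2.
have vE z : word_tail z = y' -> word_head z = b -> z = v.
  by move=> h1 h2; rewrite (word_eta z) h1 h2.
have [Sx Sy] := walk_in_endpoints WS.
exists (option (option J)).
exists (fun w => S (word_tail w) /\ word_head w = a \/ w = v).
exists (fun o w => match o with
    | Some (Some j) => [/\ F j (word_tail w) /\ word_head w <> c \/ w = u \/ w = v,
                           w <> u & w <> v]
    | Some None => [/\ S (word_tail w) /\ word_head w = b \/ w = u, w <> u & w <> v]
    | None => [/\ word_head w = c \/ w = u \/ w = v, w <> u & w <> v] end); split.
- by rewrite !card_option; lia.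
- apply: (@walk_in_leq _ _ _ (k + 1)); last by rewrite addn1.
  apply: (@walk_in_trans _ _ _ _ _ _ (word_cons a y')).
    by apply: walk_in_sub (lift a); auto.
  by apply: walk_in_edge; rewrite ?word_consK ?word_head_cons; auto; apply: edge_head.
- case=> [[j|]|]; apply: IW.
  + have [d [xd Fd dx dy W]] := inner_walk_in_head (WF j).
    apply: (@walk_in_cons _ _ _ _ _ (word_cons a d)); first by auto.
      exact: edge_tail.
    apply: (@walk_in_cons _ _ _ _ _ (word_cons b d)); first by rewrite word_consK word_head_cons; auto.
      exact: edge_head.
    apply: (walk_in_map (@edge_tail k b)) W => z [Fz|->];
      by rewrite ?word_consK ?word_head_cons; auto.
  + apply: (@walk_in_leq _ _ _ k.+1) => //.
    apply: (@walk_in_cons _ _ _ _ _ (word_cons b x')); first by auto.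
      exact: edge_head.
    by apply: walk_in_sub (lift b); auto.
  + apply: (@walk_in_leq _ _ _ (1 + (k + 1))); last by lia.
    apply: (@walk_in_cons _ _ _ _ _ (word_cons c x')); [by auto | by apply: edge_head; auto |].
    apply: (@walk_in_trans _ _ _ _ _ _ (word_cons c y')).
      apply: (walk_in_map (@edge_tail k c) (S := fun=> True)); last exact: hamming_diam.
      by move=> z _; rewrite word_head_cons; auto.
    by apply: walk_in_edge; rewrite ?word_head_cons; auto; apply: edge_head.
- have dSF j z : S (word_tail z) -> F j (word_tail z) -> False by apply: dS.
  case=> [[j|]|] z; move=> h1 [h2 h3 h4].
  + by have := dSF j z; intuition congruence.
  + by intuition congruence.
  + by intuition congruence.
- case=> [[i|]|] [[j|]|] z // [h1 h2 h3] [h4 h5 h6];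
    try (by exfalso; try (have := @dS i (word_tail z)); try (have := @dS j (word_tail z));
         intuition congruence).
  by have -> : i = j by apply: (dF i j (word_tail z)); intuition congruence.
Qed.

(** * Abstract factors *)

(** A single [m] is shared by all three factors, although larger dimensions offer more paths; this
    makes the factors interchangeable. The walk in [S] and the [m] other container paths are as many
    as the prescribed neighbours. *)
Record good_factor (T : finType) (e : rel T) (m k : nat) : Prop := GoodFactor {
  factor_pos : 0 < k;
  factor_sym : symmetric e;
  factor_irr : irreflexive e;
  factor_diam : forall x y, walk_in e (fun=> True) k x y;
  factor_nbrs : forall x, exists f : 'I_m.+1 -> T, injective f /\ forall i, e x (f i);
  factor_detour : forall x y, exists z n1 n2,
    [/\ z <> x, z <> y, n1 + n2 <= k.+1,
        walk_in e (fun=> True) n1 x z & walk_in e (fun=> True) n2 z y];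
  factor_container : forall x y, x <> y ->
    exists (S : T -> Prop) (F : 'I_m -> T -> Prop),
    [/\ walk_in e S k x y, forall i, inner_walk_in e (F i) k.+1 x y,
        forall i z, S z -> F i z -> False
      & forall i j z, F i z -> F j z -> i = j] }.

Lemma ord_embed (J : finType) n : n <= #|J| -> exists h : 'I_n -> J, injective h.
Proof.
move=> le; exists (fun i => enum_val (widen_ord le i)) => i j /enum_val_inj.
by move=> /(congr1 val) /= /val_inj.
Qed.

Lemma hamming_good_factor m k : 0 < k -> m.+1 <= 2 * k ->
  good_factor (@differ_in_one k) m k.
Proof.
move=> k0 mk; split=> //.
- exact: differ_in_one_sym.
- exact: differ_in_one_irr.
- by move=> x y; apply: hamming_diam.
- move=> x; have [J [f [cJ fI fe]]] := hamming_nbrs x.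
  have [|h hI] := @ord_embed J m.+1; first by rewrite cJ.
  by exists (f \o h); split=> [|i]; [apply: inj_comp | apply: fe].
- by case: k k0 {mk} => // k _ x y; apply: hamming_detour.
- move=> x y /hamming_container[J [S [F [cJ WS WF dS dF]]]].
  have [|h hI] := @ord_embed J m; first by lia.
  exists S, (F \o h); split=> //= [i z|i j z Fi Fj]; first exact: dS.
  exact/hI/(dF _ _ z).
Qed.

(** * The product of three factors with a label *)

(* Label [li] makes the [i]-th factor of a triple movable. *)
Notation l0 := (@None bool).
Notation l1 := (Some false).
Notation l2 := (Some true).

Definition triple_adj (T0 T1 T2 : finType) (e0 : rel T0) (e1 : rel T1) (e2 : rel T2) :
    rel (T0 * T1 * T2 * option bool) :=
  fun u v =>
    let: (x, y, z, l) := u in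
    let: (x', y', z', l') := v in
    [|| [&& x == x', y == y', z == z' & l != l'],
        [&& l == l0, l' == l0, y == y', z == z' & e0 x x'],
        [&& l == l1, l' == l1, x == x', z == z' & e1 y y']
      | [&& l == l2, l' == l2, x == x', y == y' & e2 z z']].

(** A vertex set is encoded by its slices at the three labels, so that a disjointness claim splits
    into three claims about coordinates. *)
Definition layers (T0 T1 T2 : finType) (P0 P1 P2 : T0 -> T1 -> T2 -> Prop)
    (w : T0 * T1 * T2 * option bool) : Prop :=
  let: (x, y, z, l) := w in
  match l with
  | None => P0 x y z
  | Some false => P1 x y z
  | Some true => P2 x y z
  end.

Definition with_ends (T : Type) (u v : T) (S : T -> Prop) (w : T) : Prop :=
  S w \/ w = u \/ w = v.

Section NonAdjacent.
Variables (T : finType) (e : rel T) (d : nat) (u v : T).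
Hypotheses (uv : u <> v) (nuv : ~~ e u v).

(** Since the ends are nonadjacent, the sets can be described without regard to whether they contain
    them: walks may always use the ends, and the disjointness conditions ignore them. *)
Lemma nonadj_walks2 n (S1 S2 : T -> Prop) (F : 'I_n -> T -> Prop) :
  walk_in e (with_ends u v S1) d u v -> walk_in e (with_ends u v S2) d u v ->
  (forall i, walk_in e (with_ends u v (F i)) d u v) ->
  (forall w, S1 w -> S2 w -> w <> u -> w <> v -> False) ->
  (forall i w, S1 w -> F i w -> w <> u -> w <> v -> False) ->
  (forall i w, S2 w -> F i w -> w <> u -> w <> v -> False) ->
  (forall i j w, F i w -> F j w -> w <> u -> w <> v -> i = j) ->
  disjoint_walks e n.+2 d u v.
Proof.
move=> W1 /(inner_walk_in_nonadj nuv uv) W2 WF d12 d1 d2 dF.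
have WF' i := inner_walk_in_nonadj nuv uv (WF i).
apply: (disjoint_walks2 uv W1 W2 WF').
- by move=> w [?|[?|?]] [?|[?|?]] ? ?; eauto.
- by move=> i w [?|[?|?]] [?|[?|?]] ? ?; eauto.
- by move=> i w [?|[?|?]] [?|[?|?]] ? ?; eauto.
- by move=> i j w [?|[?|?]] [?|[?|?]] ? ?; try contradiction; eauto.
Qed.

Lemma nonadj_walks3 n (S1 S2 S3 : T -> Prop) (F : 'I_n -> T -> Prop) :
  walk_in e (with_ends u v S1) d u v -> walk_in e (with_ends u v S2) d u v ->
  walk_in e (with_ends u v S3) d u v ->
  (forall i, walk_in e (with_ends u v (F i)) d u v) ->
  (forall w, S1 w -> S2 w -> w <> u -> w <> v -> False) ->
  (forall w, S1 w -> S3 w -> w <> u -> w <> v -> False) ->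
  (forall w, S2 w -> S3 w -> w <> u -> w <> v -> False) ->
  (forall i w, S1 w -> F i w -> w <> u -> w <> v -> False) ->
  (forall i w, S2 w -> F i w -> w <> u -> w <> v -> False) ->
  (forall i w, S3 w -> F i w -> w <> u -> w <> v -> False) ->
  (forall i j w, F i w -> F j w -> w <> u -> w <> v -> i = j) ->
  disjoint_walks e n.+3 d u v.
Proof.
move=> W1 /(inner_walk_in_nonadj nuv uv) W2 /(inner_walk_in_nonadj nuv uv) W3 WF.
move=> d12 d13 d23 d1 d2 d3 dF.
have WF' i := inner_walk_in_nonadj nuv uv (WF i).
apply: (disjoint_walks3 uv W1 W2 W3 WF').
1-3: by move=> w [?|[?|?]] [?|[?|?]] ? ?; eauto.
1-3: by move=> i w [?|[?|?]] [?|[?|?]] ? ?; eauto.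
by move=> i j w [?|[?|?]] [?|[?|?]] ? ?; try contradiction; eauto.
Qed.

End NonAdjacent.

Section Triple.
Variables (T0 T1 T2 : finType) (e0 : rel T0) (e1 : rel T1) (e2 : rel T2).
Local Notation E := (triple_adj e0 e1 e2).
Local Notation V := (T0 * T1 * T2 * option bool)%type.

Lemma adj0 x x' y z : e0 x x' -> E (x, y, z, l0) (x', y, z, l0).
Proof. by rewrite /= !eqxx => ->; rewrite ?orbT. Qed.
Lemma adj1 x y y' z : e1 y y' -> E (x, y, z, l1) (x, y', z, l1).
Proof. by rewrite /= !eqxx => ->; rewrite ?orbT. Qed.
Lemma adj2 x y z z' : e2 z z' -> E (x, y, z, l2) (x, y, z', l2).
Proof. by rewrite /= !eqxx => ->; rewrite ?orbT. Qed.
Lemma adj_label x y z l l' : l != l' -> E (x, y, z, l) (x, y, z, l').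
Proof. by rewrite /= !eqxx => ->. Qed.

Lemma go0 (Q : T0 -> Prop) (S : V -> Prop) p n x x' y z c :
  walk_in e0 Q p x x' -> (forall a, Q a -> S (a, y, z, l0)) ->
  walk_in E S n (x', y, z, l0) c -> walk_in E S (p + n) (x, y, z, l0) c.
Proof.
move=> W sub; apply: walk_in_trans.
by apply: (walk_in_map (f := fun a => (a, y, z, l0))) W => // a b; apply: adj0.
Qed.

Lemma go1 (Q : T1 -> Prop) (S : V -> Prop) p n x y y' z c :
  walk_in e1 Q p y y' -> (forall a, Q a -> S (x, a, z, l1)) ->
  walk_in E S n (x, y', z, l1) c -> walk_in E S (p + n) (x, y, z, l1) c.
Proof.
move=> W sub; apply: walk_in_trans.
by apply: (walk_in_map (f := fun a => (x, a, z, l1))) W => // a b; apply: adj1.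
Qed.

Lemma go2 (Q : T2 -> Prop) (S : V -> Prop) p n x y z z' c :
  walk_in e2 Q p z z' -> (forall a, Q a -> S (x, y, a, l2)) ->
  walk_in E S n (x, y, z', l2) c -> walk_in E S (p + n) (x, y, z, l2) c.
Proof.
move=> W sub; apply: walk_in_trans.
by apply: (walk_in_map (f := fun a => (x, y, a, l2))) W => // a b; apply: adj2.
Qed.

Variables (m k0 k1 k2 d : nat).
Hypotheses (g0 : good_factor e0 m k0) (g1 : good_factor e1 m k1)
  (g2 : good_factor e2 m k2) (dE : d = k0 + k1 + k2 + 6).

Lemma triple_adj_sym : symmetric E.
Proof.
move=> [[[x y] z] l] [[[x' y'] z'] l'] /=.
rewrite (factor_sym g0 x) (factor_sym g1 y) (factor_sym g2 z).
rewrite !(eq_sym x) !(eq_sym y) !(eq_sym z) !(eq_sym l l').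
by rewrite !(andbCA (l == _) (l' == _)).
Qed.

Ltac in_layers_rec :=
  solve [ trivial | split; in_layers_rec | left; in_layers_rec | right; in_layers_rec ].
Ltac in_layers := intros; rewrite /with_ends /=; in_layers_rec.

Ltac edge :=
  solve [ apply: adj_label; by []
        | apply: adj0; by []
        | apply: adj1; by []
        | apply: adj2; by [] ].

(** The proofs below read as itineraries: [step_to] takes one edge, [follow] a walk in one factor,
    and [arrive] stops. The length accumulates in an existential variable, which [lia] bounds at the
    end. *)
Ltac step_to b := eapply (walk_in_cons (y := b)); [in_layers | edge |].
Ltac follow W := first [eapply (go0 W) | eapply (go1 W) | eapply (go2 W)]; [in_layers |].
Ltac arrive := by apply: (@walk_in_refl _ _ _ 0); in_layers.
Ltac split_hyps := repeat match goal with
  | H : _ \/ _ |- _ => destruct H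
  | H : _ /\ _ |- _ => destruct H
  end.
(** Compares slices label by label; what remains is a clash of coordinate equations, or the
    injectivity of tags or disjointness of container paths. *)
Ltac separate :=
  intros; repeat match goal with _ : layers _ _ _ ?w |- _ =>
    is_var w; destruct w as [[[? ?] ?] [[]|]] end;
  simpl in *; split_hyps; try contradiction; subst;
  try contradiction; try congruence; eauto.

Ltac avoid_ends := intros w Sw; split; intros ->; solve [separate].

Let k0_gt0 := factor_pos g0.
Let k1_gt0 := factor_pos g1.
Let k2_gt0 := factor_pos g2.
Let D0 := factor_diam g0.
Let D1 := factor_diam g1.
Let D2 := factor_diam g2.

Lemma factor_neighbour (T : finType) (e : rel T) k (x : T) :
  good_factor e m k -> exists y, [/\ e x y, e y x, y <> x & x <> y].
Proof.
move=> g; have [f [_ fx]] := factor_nbrs g x; exists (f ord0).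
have nx : f ord0 <> x by move=> h; have := fx ord0; rewrite h (factor_irr g).
by split=> //; [rewrite (factor_sym g) | move/esym].
Qed.

Lemma factor_nbrs_neq (T : finType) (e : rel T) k (x : T) :
  good_factor e m k -> exists f : 'I_m.+1 -> T,
  [/\ injective f, forall i, e x (f i), forall i, e (f i) x & forall i, f i <> x].
Proof.
move=> g; have [f [fI fx]] := factor_nbrs g x; exists f; split=> // i.
  by rewrite (factor_sym g).
by move=> h; have := fx i; rewrite h (factor_irr g).
Qed.

(** * Two ends with label [l0] *)

(** The container of the first factor gives [m.+1] paths at label [l0]. The other two leave through
    [l1] and [l2] and cross at a neighbour of [Y] or of [Z]. The ends may be adjacent, so interiors
    are supplied explicitly. *)
Lemma label0_x X X' Y Z : X <> X' ->
  disjoint_walks E m.+3 d (X, Y, Z, l0) (X', Y, Z, l0).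
Proof.
move=> XX'.
have [S [F [WS WF dS dF]]] := factor_container g0 XX'.
have [SX SX'] := walk_in_endpoints WS.
have [Y1 [YY1 Y1Y nY nY']] := factor_neighbour Y g1.
have [Z1 [ZZ1 Z1Z nZ nZ']] := factor_neighbour Z g2.
apply: (@disjoint_walks3 _ _ _ _ _ m
  (layers (fun x y z => S x /\ y = Y /\ z = Z) (fun _ _ _ => False) (fun _ _ _ => False))
  (layers (fun x y z => y = Y1 /\ z = Z) (fun _ _ z => z = Z) (fun _ _ _ => False))
  (layers (fun x y z => y = Y /\ z = Z1) (fun _ _ _ => False) (fun _ y _ => y = Y))
  (fun i => layers (fun x y z => F i x /\ y = Y /\ z = Z)
                   (fun _ _ _ => False) (fun _ _ _ => False))).
- by case.
- eapply walk_in_leq; [follow WS; arrive | lia].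
- eapply inner_walk_in_leq.
    apply: (inner_walk_in_ends (a := (X, Y, Z, l1)) (b := (X', Y, Z, l1)));
      [avoid_ends | edge | edge |].
    step_to (X, Y1, Z, l1); step_to (X, Y1, Z, l0); follow (D0 X X').
    step_to (X', Y1, Z, l1); step_to (X', Y, Z, l1); arrive.
  lia.
- eapply inner_walk_in_leq.
    apply: (inner_walk_in_ends (a := (X, Y, Z, l2)) (b := (X', Y, Z, l2)));
      [avoid_ends | edge | edge |].
    step_to (X, Y, Z1, l2); step_to (X, Y, Z1, l0); follow (D0 X X').
    step_to (X', Y, Z1, l2); step_to (X', Y, Z, l2); arrive.
  lia.
- move=> i; apply: (@inner_walk_in_leq _ _ _ k0.+1); last by lia.
  apply: (inner_walk_in_map (f := fun a => (a, Y, Z, l0))) (WF i).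
  + by move=> a b [].
  + by move=> a b; apply: adj0.
  + by in_layers.
all: by separate.
Qed.

(** Each neighbour [f i] of [X] tags one path. The two remaining paths keep [x = X] and rewrite [y]
    and [z] in opposite orders. *)
Lemma label0_yz X Y Y' Z Z' : Y <> Y' -> Z <> Z' ->
  disjoint_walks E m.+3 d (X, Y, Z, l0) (X, Y', Z', l0).
Proof.
move=> YY' ZZ'.
have [f [fI Xf fX nf]] := factor_nbrs_neq X g0.
apply: (@nonadj_walks2 _ _ _ _ _ _ _ m.+1
  (layers (fun _ _ _ => False) (fun x y z => x = X /\ z = Z) (fun x y z => x = X /\ y = Y'))
  (layers (fun _ _ _ => False) (fun x y z => x = X /\ z = Z') (fun x y z => x = X /\ y = Y))
  (fun i => layers (fun x _ _ => x = f i) (fun x _ _ => x = f i) (fun x _ _ => x = f i))).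
- congruence.
- by rewrite /= (introF eqP YY') ?andbF.
- eapply walk_in_leq.
    step_to (X, Y, Z, l1); follow (D1 Y Y'); step_to (X, Y', Z, l2); follow (D2 Z Z').
    step_to (X, Y', Z', l0); arrive.
  lia.
- eapply walk_in_leq.
    step_to (X, Y, Z, l2); follow (D2 Z Z'); step_to (X, Y, Z', l1); follow (D1 Y Y').
    step_to (X, Y', Z', l0); arrive.
  lia.
- move=> i; eapply walk_in_leq.
    step_to (f i, Y, Z, l0); step_to (f i, Y, Z, l1); follow (D1 Y Y').
    step_to (f i, Y', Z, l2); follow (D2 Z Z'); step_to (f i, Y', Z', l0).
    step_to (X, Y', Z', l0); arrive.
  lia.
- separate.
- move=> i; have := nf i; separate.
- move=> i; have := nf i; separate.
- separate.
Qed.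

(** The tags are again neighbours of [X]; the two untagged paths keep [x = X] and change [y] at [Z]
    and at its neighbour [Z1]. *)
Lemma label0_y X Y Y' Z : Y <> Y' ->
  disjoint_walks E m.+3 d (X, Y, Z, l0) (X, Y', Z, l0).
Proof.
move=> YY'.
have [f [fI Xf fX nf]] := factor_nbrs_neq X g0.
have [Z1 [ZZ1 Z1Z nZ nZ']] := factor_neighbour Z g2.
apply: (@nonadj_walks2 _ _ _ _ _ _ _ m.+1
  (layers (fun _ _ _ => False) (fun x _ z => x = X /\ z = Z) (fun _ _ _ => False))
  (layers (fun _ _ _ => False) (fun x _ z => x = X /\ z = Z1) (fun x _ _ => x = X))
  (fun i => layers (fun x _ _ => x = f i) (fun x _ _ => x = f i) (fun x _ _ => x = f i))).
- congruence.
- by rewrite /= (introF eqP YY') ?andbF.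
- eapply walk_in_leq.
    step_to (X, Y, Z, l1); follow (D1 Y Y'); step_to (X, Y', Z, l0); arrive.
  lia.
- eapply walk_in_leq.
    step_to (X, Y, Z, l2); step_to (X, Y, Z1, l2); step_to (X, Y, Z1, l1).
    follow (D1 Y Y'); step_to (X, Y', Z1, l2); step_to (X, Y', Z, l2).
    step_to (X, Y', Z, l0); arrive.
  lia.
- move=> i; eapply walk_in_leq.
    step_to (f i, Y, Z, l0); step_to (f i, Y, Z, l1); follow (D1 Y Y').
    step_to (f i, Y', Z, l0); step_to (X, Y', Z, l0); arrive.
  lia.
- separate.
- move=> i; have := nf i; separate.
- move=> i; have := nf i; separate.
- separate.
Qed.

(** The walk in [S] serves twice, before and after the change of [y]. The other container paths
    change [y] at their first interior vertex, and the path through [Z1] has label [l2] to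
    itself. *)
Lemma label0_xy X X' Y Y' Z : X <> X' -> Y <> Y' ->
  disjoint_walks E m.+3 d (X, Y, Z, l0) (X', Y', Z, l0).
Proof.
move=> XX' YY'.
have [S [F [WS WF dS dF]]] := factor_container g0 XX'.
have [SX SX'] := walk_in_endpoints WS.
have [Z1 [ZZ1 Z1Z nZ nZ']] := factor_neighbour Z g2.
apply: (@nonadj_walks3 _ _ _ _ _ _ _ m
  (layers (fun x y z => S x /\ y = Y /\ z = Z) (fun x _ z => x = X' /\ z = Z)
          (fun _ _ _ => False))
  (layers (fun x y z => S x /\ y = Y' /\ z = Z) (fun x _ z => x = X /\ z = Z)
          (fun _ _ _ => False))
  (layers (fun x y z => y = Y' /\ z = Z1) (fun x _ z => x = X /\ z = Z1)
          (fun _ _ _ => True))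
  (fun i => layers (fun x _ z => F i x /\ z = Z) (fun x _ z => F i x /\ z = Z)
                   (fun _ _ _ => False))).
- congruence.
- by rewrite /= (introF eqP YY') ?andbF.
- eapply walk_in_leq.
    follow WS; step_to (X', Y, Z, l1); follow (D1 Y Y'); step_to (X', Y', Z, l0); arrive.
  lia.
- eapply walk_in_leq.
    step_to (X, Y, Z, l1); follow (D1 Y Y'); step_to (X, Y', Z, l0); follow WS; arrive.
  lia.
(* Seven single edges occur here; the one in excess of six is absorbed by [0 < k2]. *)
- eapply walk_in_leq.
    step_to (X, Y, Z, l2); step_to (X, Y, Z1, l2); step_to (X, Y, Z1, l1).
    follow (D1 Y Y'); step_to (X, Y', Z1, l0); follow (D0 X X').
    step_to (X', Y', Z1, l2); step_to (X', Y', Z, l2); step_to (X', Y', Z, l0); arrive.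
  lia.
- move=> i; have [a [Xa Fa aX aX' Wa]] := inner_walk_in_head (WF i).
  eapply walk_in_leq.
    step_to (a, Y, Z, l0); step_to (a, Y, Z, l1); follow (D1 Y Y').
    step_to (a, Y', Z, l0); eapply (go0 Wa); [by move=> c [Fc | ->]; in_layers | arrive].
  lia.
all: separate.
Qed.

(** The three untagged paths rewrite the coordinates in the cyclic orders [x y z], [y z x] and
    [z x y]. The tagged ones change [y] and [z] at the first interior vertex of a container path. *)
Lemma label0_xyz X X' Y Y' Z Z' : X <> X' -> Y <> Y' -> Z <> Z' ->
  disjoint_walks E m.+3 d (X, Y, Z, l0) (X', Y', Z', l0).
Proof.
move=> XX' YY' ZZ'.
have [S [F [WS WF dS dF]]] := factor_container g0 XX'.
have [SX SX'] := walk_in_endpoints WS.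
apply: (@nonadj_walks3 _ _ _ _ _ _ _ m
  (layers (fun x y z => S x /\ y = Y /\ z = Z) (fun x _ z => x = X' /\ z = Z)
          (fun x y _ => x = X' /\ y = Y'))
  (layers (fun x y z => S x /\ y = Y' /\ z = Z') (fun x _ z => x = X /\ z = Z)
          (fun x y _ => x = X /\ y = Y'))
  (layers (fun x y z => y = Y /\ z = Z') (fun x _ z => z = Z') (fun _ y _ => y = Y))
  (fun i => layers (fun x y z => F i x /\ (y = Y /\ z = Z \/ y = Y' /\ z = Z'))
                   (fun x _ z => F i x /\ z = Z) (fun x y _ => F i x /\ y = Y'))).
- congruence.
- by rewrite /= (introF eqP YY') ?andbF.
- eapply walk_in_leq.
    follow WS; step_to (X', Y, Z, l1); follow (D1 Y Y'); step_to (X', Y', Z, l2).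
    follow (D2 Z Z'); step_to (X', Y', Z', l0); arrive.
  lia.
- eapply walk_in_leq.
    step_to (X, Y, Z, l1); follow (D1 Y Y'); step_to (X, Y', Z, l2).
    follow (D2 Z Z'); step_to (X, Y', Z', l0); follow WS; arrive.
  lia.
- eapply walk_in_leq.
    step_to (X, Y, Z, l2); follow (D2 Z Z'); step_to (X, Y, Z', l0).
    follow (D0 X X'); step_to (X', Y, Z', l1); follow (D1 Y Y').
    step_to (X', Y', Z', l0); arrive.
  lia.
- move=> i; have [a [Xa Fa aX aX' Wa]] := inner_walk_in_head (WF i).
  eapply walk_in_leq.
    step_to (a, Y, Z, l0); step_to (a, Y, Z, l1); follow (D1 Y Y').
    step_to (a, Y', Z, l2); follow (D2 Z Z'); step_to (a, Y', Z', l0).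
    eapply (go0 Wa); [by move=> c [Fc | ->]; in_layers | arrive].
  lia.
all: separate.
Qed.

(** * Ends with labels [l0] and [l1] *)

(** A tagged path carries [f i] until [y] has become [g i], which is its tag from then on. Of the
    two detours, [Xt] separates the untagged paths at label [l2] and [Zt] at the other labels. Every
    length bound obtained is the full [k0 + k1 + k2 + 6]. *)
Lemma label01_yz X X' Y Y' Z Z' : Y <> Y' -> Z <> Z' ->
  disjoint_walks E m.+3 d (X, Y, Z, l0) (X', Y', Z', l1).
Proof.
move=> YY' ZZ'.
have [f [fI Xf fX nf]] := factor_nbrs_neq X g0.
have [g [gI Yg gY ng]] := factor_nbrs_neq Y' g1.
have [Xt [a [b [nXt nXt' ab Wa Wb]]]] := factor_detour g0 X X'.
have [Zt [p [q [nZt nZt' pq Wp Wq]]]] := factor_detour g2 Z Z'.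
apply: (@nonadj_walks2 _ _ _ _ _ _ _ m.+1
  (layers (fun _ y z => y = Y' /\ (z = Z \/ z = Z')) (fun x _ z => x = X /\ z = Z)
          (fun x y _ => x = Xt /\ y = Y'))
  (layers (fun _ _ z => z = Zt) (fun _ _ z => z = Zt)
          (fun x y _ => x = X /\ y = Y \/ x = X' /\ y = Y'))
  (fun i => layers (fun x y z => x = f i /\ y = Y /\ z = Z \/ y = g i /\ z = Z')
                   (fun x y z => x = f i /\ z = Z \/ y = g i /\ z = Z')
                   (fun x y _ => x = f i /\ y = g i))).
- congruence.
- by rewrite /= (introF eqP YY') ?andbF.
- eapply walk_in_leq.
    step_to (X, Y, Z, l1); follow (D1 Y Y'); step_to (X, Y', Z, l0); follow Wa.
    step_to (Xt, Y', Z, l2); follow (D2 Z Z'); step_to (Xt, Y', Z', l0); follow Wb.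
    step_to (X', Y', Z', l1); arrive.
  lia.
- eapply walk_in_leq.
    step_to (X, Y, Z, l2); follow Wp; step_to (X, Y, Zt, l0); follow (D0 X X').
    step_to (X', Y, Zt, l1); follow (D1 Y Y'); step_to (X', Y', Zt, l2); follow Wq.
    step_to (X', Y', Z', l1); arrive.
  lia.
- move=> i; eapply walk_in_leq.
    step_to (f i, Y, Z, l0); step_to (f i, Y, Z, l1); follow (D1 Y (g i)).
    step_to (f i, g i, Z, l2); follow (D2 Z Z'); step_to (f i, g i, Z', l0).
    follow (D0 (f i) X'); step_to (X', g i, Z', l1); step_to (X', Y', Z', l1); arrive.
  lia.
- separate.
- move=> i; have := nf i; have := ng i; separate.
- move=> i; have := nf i; have := ng i; separate.
- move=> i j; separate.
Qed.

(** One path changes [z] directly at label [l2]. The index [ord0] is spent on two paths, one through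
    [f ord0] alone and one through [g ord0] alone; the lifted indices tag the other [m] by pairs. *)
Lemma label01_z X Y Z Z' : Z <> Z' ->
  disjoint_walks E m.+3 d (X, Y, Z, l0) (X, Y, Z', l1).
Proof.
move=> ZZ'.
have [f [fI Xf fX nf]] := factor_nbrs_neq X g0.
have [g [gI Yg gY ng]] := factor_nbrs_neq Y g1.
have f0 i : f (lift ord0 i) <> f ord0.
  by move/fI/eqP; rewrite eq_sym (negPf (neq_lift _ _)).
have g0' i : g (lift ord0 i) <> g ord0.
  by move/gI/eqP; rewrite eq_sym (negPf (neq_lift _ _)).
have fI' i j : f (lift ord0 i) = f (lift ord0 j) -> i = j by move/fI/lift_inj.
have gI' i j : g (lift ord0 i) = g (lift ord0 j) -> i = j by move/gI/lift_inj.
apply: (@nonadj_walks3 _ _ _ _ _ _ _ m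
  (layers (fun _ _ _ => False) (fun _ _ _ => False) (fun x y _ => x = X /\ y = Y))
  (layers (fun x y z => x = f ord0 /\ y = Y /\ z = Z \/ y = Y /\ z = Z')
          (fun _ _ _ => False) (fun x y _ => x = f ord0 /\ y = Y))
  (layers (fun _ _ _ => False) (fun x y z => x = X /\ z = Z \/ y = g ord0 /\ z = Z')
          (fun x y _ => x = X /\ y = g ord0))
  (fun i => layers (fun x y z => x = f (lift ord0 i) /\ y = Y /\ z = Z
                                 \/ y = g (lift ord0 i) /\ z = Z')
                   (fun x y z => x = f (lift ord0 i) /\ z = Z
                                 \/ y = g (lift ord0 i) /\ z = Z')
                   (fun x y _ => x = f (lift ord0 i) /\ y = g (lift ord0 i)))).
- congruence.
- by rewrite /= (introF eqP ZZ') ?andbF.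
- eapply walk_in_leq.
    step_to (X, Y, Z, l2); follow (D2 Z Z'); step_to (X, Y, Z', l1); arrive.
  lia.
- eapply walk_in_leq.
    step_to (f ord0, Y, Z, l0); step_to (f ord0, Y, Z, l2); follow (D2 Z Z').
    step_to (f ord0, Y, Z', l0); step_to (X, Y, Z', l0); step_to (X, Y, Z', l1); arrive.
  lia.
- eapply walk_in_leq.
    step_to (X, Y, Z, l1); step_to (X, g ord0, Z, l1); step_to (X, g ord0, Z, l2).
    follow (D2 Z Z'); step_to (X, g ord0, Z', l1); step_to (X, Y, Z', l1); arrive.
  lia.
(* Eight single edges occur here; the surplus of two is absorbed by [0 < k0] and [0 < k1]. *)
- move=> i; eapply walk_in_leq.
    step_to (f (lift ord0 i), Y, Z, l0); step_to (f (lift ord0 i), Y, Z, l1).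
    step_to (f (lift ord0 i), g (lift ord0 i), Z, l1).
    step_to (f (lift ord0 i), g (lift ord0 i), Z, l2); follow (D2 Z Z').
    step_to (f (lift ord0 i), g (lift ord0 i), Z', l0).
    step_to (X, g (lift ord0 i), Z', l0); step_to (X, g (lift ord0 i), Z', l1).
    step_to (X, Y, Z', l1); arrive.
  lia.
- have := nf ord0; have := ng ord0; separate.
- have := nf ord0; have := ng ord0; separate.
- have := nf ord0; have := ng ord0; separate.
1-3: move=> i; have := nf (lift ord0 i); have := ng (lift ord0 i); have := f0 i; have := g0' i;
  separate.
- move=> i j; separate.
Qed.

(** One path is the edge itself and one passes through label [l2]. Each other path has length 7: it
    moves to [f i], then at [l1] to [g i], returns to [X] at [l0], and returns to [Y] at [l1]. *)
Lemma label01_eq X Y Z :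
  disjoint_walks E m.+3 d (X, Y, Z, l0) (X, Y, Z, l1).
Proof.
have [f [fI Xf fX nf]] := factor_nbrs_neq X g0.
have [g [gI Yg gY ng]] := factor_nbrs_neq Y g1.
apply: (@disjoint_walks2 _ _ _ _ _ m.+1
  (with_ends (X, Y, Z, l0) (X, Y, Z, l1) (fun=> False))
  (layers (fun _ _ _ => False) (fun _ _ _ => False) (fun _ _ _ => True))
  (fun i => layers (fun x y _ => x = f i /\ y = Y \/ y = g i)
                   (fun x y _ => x = f i \/ x = X /\ y = g i) (fun _ _ _ => False))).
- by case.
- eapply walk_in_leq; [step_to (X, Y, Z, l1); arrive | lia].
- eapply inner_walk_in_leq.
    apply: (inner_walk_in_ends (a := (X, Y, Z, l2)) (b := (X, Y, Z, l2)));
      [avoid_ends | edge | edge | arrive].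
  lia.
- move=> i; have nfi := nf i; have ngi := ng i; eapply inner_walk_in_leq.
    apply: (inner_walk_in_ends (a := (f i, Y, Z, l0)) (b := (X, g i, Z, l1)));
      [avoid_ends | edge | edge |].
    step_to (f i, Y, Z, l1); step_to (f i, g i, Z, l1); step_to (f i, g i, Z, l0).
    step_to (X, g i, Z, l0); step_to (X, g i, Z, l1); arrive.
  lia.
- by move=> w [] // [].
- by move=> i w [] // [].
- separate.
- move=> i j; have := nf i; have := ng i; have := nf j; have := ng j; separate.
Qed.

(** The first tags are neighbours of [X], the second ones the last interior vertices of container
    paths in the second factor. The neighbour [f ord0] is kept for a path that reaches [Y'] before
    returning to [X]; one more path crosses at [Z1]. *)
Lemma label01_y X Y Y' Z : Y <> Y' ->
  disjoint_walks E m.+3 d (X, Y, Z, l0) (X, Y', Z, l1).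
Proof.
move=> YY'.
have [S [G [WS WG dS dG]]] := factor_container g1 YY'.
have [SY SY'] := walk_in_endpoints WS.
have [f [fI Xf fX nf]] := factor_nbrs_neq X g0.
have [Z1 [ZZ1 Z1Z nZ nZ']] := factor_neighbour Z g2.
have f0 i : f (lift ord0 i) <> f ord0.
  by move/fI/eqP; rewrite eq_sym (negPf (neq_lift _ _)).
have fI' i j : f (lift ord0 i) = f (lift ord0 j) -> i = j by move/fI/lift_inj.
apply: (@nonadj_walks3 _ _ _ _ _ _ _ m
  (layers (fun _ _ _ => False) (fun x y z => x = X /\ S y /\ z = Z) (fun _ _ _ => False))
  (layers (fun x y z => (x = f ord0 /\ y = Y \/ y = Y') /\ z = Z)
          (fun x _ z => x = f ord0 /\ z = Z) (fun _ _ _ => False))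
  (layers (fun _ _ _ => False) (fun _ _ z => z = Z1) (fun _ _ _ => True))
  (fun i => layers (fun x y z => (x = f (lift ord0 i) /\ y = Y \/ G i y) /\ z = Z)
                   (fun x y z => (x = f (lift ord0 i) \/ x = X /\ G i y) /\ z = Z)
                   (fun _ _ _ => False))).
- congruence.
- by rewrite /= (introF eqP YY') ?andbF.
- eapply walk_in_leq.
    step_to (X, Y, Z, l1); follow WS; arrive.
  lia.
- eapply walk_in_leq.
    step_to (f ord0, Y, Z, l0); step_to (f ord0, Y, Z, l1); follow (D1 Y Y').
    step_to (f ord0, Y', Z, l0); step_to (X, Y', Z, l0); step_to (X, Y', Z, l1); arrive.
  lia.
- eapply walk_in_leq.
    step_to (X, Y, Z, l2); step_to (X, Y, Z1, l2); step_to (X, Y, Z1, l1).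
    follow (D1 Y Y'); step_to (X, Y', Z1, l2); step_to (X, Y', Z, l2).
    step_to (X, Y', Z, l1); arrive.
  lia.
- move=> i; have [b [bY' Gb nb nb']] := inner_walk_in_last (WG i).
  eapply walk_in_leq.
    step_to (f (lift ord0 i), Y, Z, l0); step_to (f (lift ord0 i), Y, Z, l1).
    follow (D1 Y b); step_to (f (lift ord0 i), b, Z, l0); step_to (X, b, Z, l0).
    step_to (X, b, Z, l1); step_to (X, Y', Z, l1); arrive.
  lia.
- have := nf ord0; separate.
- have := nf ord0; separate.
- have := nf ord0; separate.
1-3: move=> i; have := nf (lift ord0 i); have := nf ord0; have := f0 i; separate.
(* [Y] lies in [S] and so in no [G i], which separates the first stretch of one tagged path from the
   last stretch of another. *)
- move=> i j; have := nf (lift ord0 i); have := nf (lift ord0 j);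
  have := fun h => dS i Y SY h; have := fun h => dS j Y SY h; separate.
Qed.

(** Both factors supply containers: a tagged path starts through the first interior vertex [a] of
    one in [F i] and ends through the last interior vertex [b] of one in [G i]. In between,
    arbitrary walks suffice, since the other coordinate holds the tag. *)
Lemma label01_xy X X' Y Y' Z : X <> X' -> Y <> Y' ->
  disjoint_walks E m.+3 d (X, Y, Z, l0) (X', Y', Z, l1).
Proof.
move=> XX' YY'.
have [S [F [WS WF dS dF]]] := factor_container g0 XX'.
have [R [G [WR WG dR dG]]] := factor_container g1 YY'.
have [SX SX'] := walk_in_endpoints WS.
have [RY RY'] := walk_in_endpoints WR.
have [Z1 [ZZ1 Z1Z nZ nZ']] := factor_neighbour Z g2.
apply: (@nonadj_walks3 _ _ _ _ _ _ _ m
  (layers (fun x y z => S x /\ y = Y /\ z = Z) (fun x y z => x = X' /\ R y /\ z = Z)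
          (fun _ _ _ => False))
  (layers (fun _ y z => y = Y' /\ z = Z) (fun x _ z => x = X /\ z = Z)
          (fun _ _ _ => False))
  (layers (fun _ _ z => z = Z1) (fun _ _ z => z = Z1) (fun _ _ _ => True))
  (fun i => layers (fun x y z => (F i x /\ y = Y \/ G i y) /\ z = Z)
                   (fun x y z => (F i x \/ x = X' /\ G i y) /\ z = Z)
                   (fun _ _ _ => False))).
- congruence.
- by rewrite /= (introF eqP YY') ?andbF.
- eapply walk_in_leq.
    follow WS; step_to (X', Y, Z, l1); follow WR; arrive.
  lia.
- eapply walk_in_leq.
    step_to (X, Y, Z, l1); follow (D1 Y Y'); step_to (X, Y', Z, l0).
    follow (D0 X X'); step_to (X', Y', Z, l1); arrive.
  lia.
(* Again seven single edges, with [0 < k2] making room. *)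
- eapply walk_in_leq.
    step_to (X, Y, Z, l2); step_to (X, Y, Z1, l2); step_to (X, Y, Z1, l0).
    follow (D0 X X'); step_to (X', Y, Z1, l1); follow (D1 Y Y').
    step_to (X', Y', Z1, l2); step_to (X', Y', Z, l2); step_to (X', Y', Z, l1); arrive.
  lia.
- move=> i; have [a [Xa Fa na na' _]] := inner_walk_in_head (WF i).
  have [b [bY' Gb nb nb']] := inner_walk_in_last (WG i).
  eapply walk_in_leq.
    step_to (a, Y, Z, l0); step_to (a, Y, Z, l1); follow (D1 Y b).
    step_to (a, b, Z, l0); follow (D0 a X'); step_to (X', b, Z, l1).
    step_to (X', Y', Z, l1); arrive.
  lia.
- separate.
- separate.
- separate.
- separate.
- separate.
- separate.
- move=> i j; have := fun h => dR i Y RY h; have := fun h => dR j Y RY h;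
    have := fun h => dS i X' SX' h; have := fun h => dS j X' SX' h; separate.
Qed.

End Triple.

(** * Reduction to two label pairs by symmetry *)

Definition label_swap01 (l : option bool) : option bool :=
  match l with None => l1 | Some false => l0 | Some true => l2 end.
Definition label_swap12 (l : option bool) : option bool := omap negb l.

Lemma walks_swap01 (T0 T1 T2 : finType) (e0 : rel T0) (e1 : rel T1) (e2 : rel T2)
    b d x y z l x' y' z' l' :
  disjoint_walks (triple_adj e1 e0 e2) b d (y, x, z, l) (y', x', z', l') ->
  disjoint_walks (triple_adj e0 e1 e2) b d
    (x, y, z, label_swap01 l) (x', y', z', label_swap01 l').
Proof.
apply: (disjoint_walks_map (f := fun w : T1 * T0 * T2 * option bool =>
  let: (y, x, z, l) := w in (x, y, z, label_swap01 l))).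
- by move=> [[[? ?] ?] [[]|]] [[[? ?] ?] [[]|]] [] // -> -> ->.
- move=> [[[a c] g] [[]|]] [[[a' c'] g'] [[]|]] /=; rewrite ?orbF ?andbF ?andbT //=;
    by rewrite andbCA.
Qed.

Lemma walks_swap12 (T0 T1 T2 : finType) (e0 : rel T0) (e1 : rel T1) (e2 : rel T2)
    b d x y z l x' y' z' l' :
  disjoint_walks (triple_adj e0 e2 e1) b d (x, z, y, l) (x', z', y', l') ->
  disjoint_walks (triple_adj e0 e1 e2) b d
    (x, y, z, label_swap12 l) (x', y', z', label_swap12 l').
Proof.
apply: (disjoint_walks_map (f := fun w : T0 * T2 * T1 * option bool =>
  let: (x, z, y, l) := w in (x, y, z, label_swap12 l))).
- by move=> [[[? ?] ?] [[]|]] [[[? ?] ?] [[]|]] [] // -> -> ->.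
- move=> [[[a c] g] [[]|]] [[[a' c'] g'] [[]|]] /=; rewrite ?orbF ?andbF ?andbT //=;
    by case: (c == c'); case: (g == g').
Qed.

(** Exchanging the last two factors fixes [l0], so the cases where only [z], or only [x] and [z],
    change follow from those for [y]. *)
Lemma label0_walks (T0 T1 T2 : finType) (e0 : rel T0) (e1 : rel T1) (e2 : rel T2)
    m k0 k1 k2 d X Y Z X' Y' Z' :
  good_factor e0 m k0 -> good_factor e1 m k1 -> good_factor e2 m k2 ->
  d = k0 + k1 + k2 + 6 -> (X, Y, Z) <> (X', Y', Z') ->
  disjoint_walks (triple_adj e0 e1 e2) m.+3 d (X, Y, Z, l0) (X', Y', Z', l0).
Proof.
move=> g0 g1 g2 dE neq.
have dE' : d = k0 + k2 + k1 + 6 by lia.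
have [XX|/eqP XX] := eqVneq X X'; have [YY|/eqP YY] := eqVneq Y Y';
  have [ZZ|/eqP ZZ] := eqVneq Z Z'; subst.
- by case: neq.
- by apply: (walks_swap12 (l := l0) (l' := l0)); apply: (label0_y g0 g2 g1).
- by apply: (label0_y g0 g1 g2).
- by apply: (label0_yz g0 g1 g2).
- by apply: (label0_x g0 g1 g2).
- by apply: (walks_swap12 (l := l0) (l' := l0)); apply: (label0_xy g0 g2 g1).
- by apply: (label0_xy g0 g1 g2).
- by apply: (label0_xyz g0 g1 g2).
Qed.

Lemma label01_walks (T0 T1 T2 : finType) (e0 : rel T0) (e1 : rel T1) (e2 : rel T2)
    m k0 k1 k2 d X Y Z X' Y' Z' :
  good_factor e0 m k0 -> good_factor e1 m k1 -> good_factor e2 m k2 ->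
  d = k0 + k1 + k2 + 6 ->
  disjoint_walks (triple_adj e0 e1 e2) m.+3 d (X, Y, Z, l0) (X', Y', Z', l1).
Proof.
move=> g0 g1 g2 dE.
have dE' : d = k1 + k0 + k2 + 6 by lia.
(* Reversal combined with the exchange of the first two factors preserves the label pair [(l0, l1)];
   this covers [X <> X'] with [Y = Y']. *)
have rev : disjoint_walks (triple_adj e1 e0 e2) m.+3 d (Y', X', Z', l0) (Y, X, Z, l1) ->
    disjoint_walks (triple_adj e0 e1 e2) m.+3 d (X, Y, Z, l0) (X', Y', Z', l1).
  move=> W; apply: disjoint_walks_sym; first exact: triple_adj_sym g0 g1 g2.
  exact: walks_swap01 W.
have [XX|/eqP XX] := eqVneq X X'; have [YY|/eqP YY] := eqVneq Y Y';
  have [ZZ|/eqP ZZ] := eqVneq Z Z'; subst.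
- by apply: (label01_eq g0 g1 g2).
- by apply: (label01_z g0 g1 g2).
- by apply: (label01_y g0 g1 g2).
- by apply: (label01_yz g0 g1 g2).
- by apply: rev; apply: (label01_y g1 g0 g2) => //; apply: nesym.
- by apply: rev; apply: (label01_yz g1 g0 g2) => //; apply: nesym.
- by apply: (label01_xy g0 g1 g2).
- by apply: (label01_yz g0 g1 g2).
Qed.

Lemma triple_walks (T0 T1 T2 : finType) (e0 : rel T0) (e1 : rel T1) (e2 : rel T2)
    m k0 k1 k2 d u v :
  good_factor e0 m k0 -> good_factor e1 m k1 -> good_factor e2 m k2 ->
  d = k0 + k1 + k2 + 6 -> u <> v ->
  disjoint_walks (triple_adj e0 e1 e2) m.+3 d u v.
Proof.
case: u v => [[[X Y] Z] l] [[[X' Y'] Z'] l'] g0 g1 g2 dE neq.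
case: l l' neq => [[]|] [[]|] neq.
- apply: (walks_swap12 (l := l1) (l' := l1)); apply: (walks_swap01 (l := l0) (l' := l0)).
  by apply: (label0_walks g2 g0 g1); [lia | congruence].
- apply: (walks_swap12 (l := l1) (l' := l2)); apply: (walks_swap01 (l := l0) (l' := l2)).
  apply: (walks_swap12 (l := l0) (l' := l1)).
  by apply: (label01_walks _ _ _ _ _ _ g2 g1 g0); lia.
- apply: (walks_swap12 (l := l1) (l' := l0)); apply: (walks_swap01 (l := l0) (l' := l1)).
  by apply: (label01_walks _ _ _ _ _ _ g2 g0 g1); lia.
- apply: (walks_swap01 (l := l0) (l' := l2)); apply: (walks_swap12 (l := l0) (l' := l1)).
  by apply: (label01_walks _ _ _ _ _ _ g1 g2 g0); lia.
- apply: (walks_swap01 (l := l0) (l' := l0)).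
  by apply: (label0_walks g1 g0 g2); [lia | congruence].
- apply: (walks_swap01 (l := l0) (l' := l1)).
  by apply: (label01_walks _ _ _ _ _ _ g1 g0 g2); lia.
- apply: (walks_swap12 (l := l0) (l' := l1)).
  by apply: (label01_walks _ _ _ _ _ _ g0 g2 g1); lia.
- exact: (label01_walks _ _ _ _ _ _ g0 g1 g2).
- by apply: (label0_walks g0 g1 g2) => //; congruence.
Qed.

(** * Transfer to the exchanged 3-ary cube *)

Definition label_ord (l : option bool) : 'I_3 :=
  match l with None => inord 0 | Some false => inord 1 | Some true => inord 2 end.

Definition ord_label (i : 'I_3) : option bool :=
  match val i with 0 => l0 | 1 => l1 | _ => l2 end.

Lemma label_ordK : cancel label_ord ord_label.
Proof. by case=> [[]|]; rewrite /ord_label /= inordK. Qed.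

Lemma ord_labelK : cancel ord_label label_ord.
Proof. by case=> [[|[|[|?]]] lt] //; apply/val_inj; rewrite /= inordK. Qed.

Theorem theorem2 (r s t : nat) :
  1 <= r -> r <= s -> s <= t ->
  wide_diameter_le (@E3C_adj r s t) (2 * r + 2) (r + s + t + 6).
Proof.
move=> r_gt0 rs st.
(* Here [m] is [2 * r - 1], one less than the number of neighbours in the smallest factor. *)
have -> : 2 * r + 2 = (2 * r).-1.+3 by lia.
have gt : good_factor (@differ_in_one t) (2 * r).-1 t by apply: hamming_good_factor; lia.
have gs : good_factor (@differ_in_one s) (2 * r).-1 s by apply: hamming_good_factor; lia.
have gr : good_factor (@differ_in_one r) (2 * r).-1 r by apply: hamming_good_factor; lia.
(* The factors are listed in reverse order because [d = 0] frees the last word [C] and [d = 2] the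
   first word [A]. *)
pose f (w : word t * word s * word r * option bool) : E3C_vertex r s t :=
  let: (C, B, A, l) := w in (A, B, C, label_ord l).
have fI : injective f.
  by move=> [[[? ?] ?] ?] [[[? ?] ?] ?] [-> -> -> /(can_inj label_ordK) ->].
have fhom : {homo f : u v / triple_adj (@differ_in_one t) (@differ_in_one s)
                             (@differ_in_one r) u v >-> E3C_adj u v}.
  move=> [[[C B] A] l] [[[C' B'] A'] l'] /or4P[].
  - by case/and4P=> /eqP-> /eqP-> /eqP-> ll'; rewrite /= !eqxx (can_eq label_ordK) ll'.
  - by case/and5P=> /eqP-> /eqP-> /eqP-> /eqP-> h; rewrite /= h !eqxx !inordK // ?orbT.
  - by case/and5P=> /eqP-> /eqP-> /eqP-> /eqP-> h; rewrite /= h !eqxx !inordK // ?orbT.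
  - by case/and5P=> /eqP-> /eqP-> /eqP-> /eqP-> h; rewrite /= h !eqxx !inordK // ?orbT.
move=> [[[A B] C] i] [[[A' B'] C'] i'] /eqP neq.
rewrite -[i]ord_labelK -[i']ord_labelK.
apply: (disjoint_walks_map (u := (C, B, A, ord_label i)) (v := (C', B', A', ord_label i'))
          fI fhom).
apply: (triple_walks gt gs gr); first by lia.
by move=> [CC BB AA /(can_inj ord_labelK) ii]; apply: neq; rewrite CC BB AA ii.
Qed.
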